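(* Let $p\in[1,\infty)$, let $G$ be a countable discrete group, let $\mathbb{L}$ be a proper length function on $G$, and let $D=D_{\mathbb{L}}$ be the operator of multiplication by $\mathbb{L}$ on $\ell^p(G)$. Then $(F^p_{\mathrm r}(G),\ell^p(G),D)$ is an $L^p$-spectral triple. That is: 1. $(I+D^2)^{-1}\in\mathcal{K}(\ell^p(G))$; 2. $(D-\lambda I)^{-1}\in\mathcal{K}(\ell^p(G))$ for all $\lambda\in\mathbb{C}\setminus\sigma(D)$; 3. $\{a\in F^p_{\mathrm r}(G) : \|[D,a]\|<\infty\}$ is a norm dense subalgebra of $F^p_{\mathrm r}(G)$.
   Context: A length function on a group $G$ is a map $\mathbb{L}:G\to[0,\infty)$ such that $\mathbb{L}(x)=0$ if and only if $x=1_G$, $\mathbb{L}(xy)\le\mathbb{L}(x)+\mathbb{L}(y)$, and $\mathbb{L}(x^{-1})=\mathbb{L}(x)$ for all $x,y\in G$. It is proper if $B_{\mathbb{L}}(r)=\{x\in G:\mathbb{L}(x)\le r\}$ is finite for every $r\ge 0$. $C_c(G)$ is the space of finitely supported functions $G\to\mathbb{C}$. For $f\in\ell^1(G)$ and $\xi\in\ell^p(G)$, $(f*\xi)(x)=\sum_{y\in G}f(y)\xi(y^{-1}x)$, and $\lambda_p:\ell^1(G)\to\mathcal{B}(\ell^p(G))$ is $\lambda_p(f)\xi=f*\xi$. The reduced $L^p$-operator group algebra $F^p_{\mathrm r}(G)$ is the norm closure of $\lambda_p(\ell^1(G))$ in $\mathcal{B}(\ell^p(G))$, acting on $\ell^p(G)$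 by inclusion. $D_{\mathbb{L}}:C_c(G)\to\ell^p(G)$ is $(D_{\mathbb{L}}\xi)(x)=\mathbb{L}(x)\xi(x)$. The inverses and the spectrum $\sigma(D)$ are understood for the closure of $D_{\mathbb{L}}$ in $\ell^p(G)$, which is again denoted $D$ (equivalently, $(I+D^2)^{-1}$ is the continuous extension of the inverse defined on the dense range). $\mathcal{B}(E)$ and $\mathcal{K}(E)$ are the bounded and compact operators on a Banach space $E$. The spectrum $\sigma(D)$ is the complement in $\mathbb{C}$ of the set of $\lambda$ for which $D-\lambda I:\mathrm{dom}(D)\to E$ has a bounded everywhere-defined inverse. For a bounded operator $a$, $\|[D,a]\|<\infty$ means that $a$ maps $\mathrm{dom}(D)$ into itself and $[D,a]=Da-aD$ extends to a bounded operator, whose norm is $\|[D,a]\|$. *)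

(* Defs.v *)
From HB Require Import structures.
From mathcomp Require Import all_boot all_order all_algebra finmap.
From mathcomp Require Import all_classical all_reals all_analysis.
From mathcomp Require Import complex ring.
From mathcomp.analysis.showcase Require summability.

Set Implicit Arguments.
Unset Strict Implicit.
Unset Printing Implicit Defensive.

Import Order.TTheory GRing.Theory Num.Theory numFieldNormedType.Exports.

Local Open Scope classical_set_scope.
Local Open Scope ring_scope.
Local Open Scope complex_scope.

(** Norms over the scalar field [R[i]] take values in [R[i]]; [rnorm] is the
    same norm viewed as an element of [R]. *)

Definition rnorm (R : realType) (E : normedZmodType R[i]) (x : E) : R :=
  complex.Re `|x|.

Section Rnorm.
Context {R : realType}.
Implicit Type E : normedZmodType R[i].

Lemma rnormE E (x : E) : (rnorm x)%:C = `|x|.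
Proof. by rewrite RRe_real// normr_real. Qed.

Lemma rnorm_ge0 E (x : E) : 0 <= rnorm x.
Proof. by rewrite -lecR rnormE normr_ge0. Qed.

Lemma rnorm0 E : rnorm (0 : E) = 0.
Proof. by rewrite /rnorm normr0. Qed.

Lemma rnorm1 : rnorm (1 : R[i]) = 1.
Proof. by rewrite /rnorm normr1. Qed.

Lemma rnorm_eq0 E (x : E) : rnorm x = 0 -> x = 0.
Proof. by move=> x0; apply/eqP; rewrite -normr_eq0 -rnormE x0. Qed.

Lemma rnormD E (x y : E) : rnorm (x + y) <= rnorm x + rnorm y.
Proof. by rewrite -lecR rmorphD/= !rnormE ler_normD. Qed.

Lemma rnormN E (x : E) : rnorm (- x) = rnorm x.
Proof. by rewrite /rnorm normrN. Qed.

Lemma rnormB E (x y : E) : rnorm (x - y) = rnorm (y - x).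
Proof. by rewrite -rnormN opprB. Qed.

Lemma rnormM (z w : R[i]) : rnorm (z * w) = rnorm z * rnorm w.
Proof. by apply: complexI; rewrite rmorphM/= !rnormE normrM. Qed.

Lemma rnormZ (E : normedModType R[i]) (z : R[i]) (x : E) :
  rnorm (z *: x) = rnorm z * rnorm x.
Proof. by apply: complexI; rewrite rmorphM/= !rnormE normrZ. Qed.

Lemma rnorm_le E (x : E) (M : R) : (`|x| <= M%:C) = (rnorm x <= M).
Proof. by rewrite -rnormE lecR. Qed.

Lemma rnorm_lt E (x : E) (M : R) : (`|x| < M%:C) = (rnorm x < M).
Proof. by rewrite -rnormE ltcR. Qed.

Lemma rnormC (x : R) : rnorm (x%:C : R[i]) = `|x|.
Proof.
by rewrite /rnorm normc_def /= expr0n addr0 sqrtr_sqr.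
Qed.

Lemma rnormi : rnorm ('i%C : R[i]) = 1.
Proof. by rewrite /rnorm normc_def/= expr0n expr1n add0r sqrtr1. Qed.

End Rnorm.

Section Operators.
Context {R : realType} (E : normedModType R[i]).
Implicit Types (a b c : E -> E) (S A : set (E -> E)) (T : set (E * E)).

Definition bounded_op : set (E -> E) :=
  [set a | linear a /\ exists M : R, forall x, rnorm (a x) <= M * rnorm x].

Definition opnorm a : R := sup [set rnorm (a x) | x in [set x | rnorm x <= 1]].

Definition compact_op : set (E -> E) :=
  [set a | bounded_op a /\ precompact (a @` [set x | rnorm x <= 1])].

(** Closure in the operator norm, within the bounded operators. *)
Definition opclosure S : set (E -> E) :=
  [set a | bounded_op a /\
           forall e : R, 0 < e -> exists2 b, S b & opnorm (a - b) < e].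

Definition subalgebra S A : Prop :=
  [/\ S `<=` A,
      S 0,
      forall a b, S a -> S b -> S (a + b),
      forall (z : R[i]) a, S a -> S (z *: a)
    & forall a b, S a -> S b -> S (a \o b)].

(** Unbounded operators, given by their graphs [(x, D x)], [x] in the domain. *)
Record unbounded_op := UnboundedOp {
  graph : set (E * E);
  graph_fun : forall x y y', graph (x, y) -> graph (x, y') -> y = y';
  graph0 : graph 0;
  graph_lin : forall (z : R[i]) u v, graph u -> graph v -> graph (z *: u + v)
}.
Implicit Type D : unbounded_op.

Definition dom D : set E := [set x | exists y, graph D (x, y)].

(** Graph of [D - z I]. *)
Definition shift_graph D (z : R[i]) : set (E * E) :=
  [set u | graph D (u.1, u.2 + z *: u.1)].

(** Graph of [I + D^2], with domain the [x] such that [x] and [D x] are both in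
    [dom D]. *)
Definition one_plus_square_graph D : set (E * E) :=
  [set u | exists y z, [/\ graph D (u.1, y), graph D (y, z) & u.2 = u.1 + z]].

(** The operator with graph [T] is a bijection from its domain onto [E], and
    its inverse is the bounded operator [b]. *)
Definition bounded_inverse T b : Prop :=
  bounded_op b /\ forall x y, T (x, y) <-> x = b y.

Definition spectrum D : set R[i] :=
  [set z | ~ exists b, bounded_inverse (shift_graph D z) b].

(** The bounded operator [a] maps [dom D] into itself, and [D a - a D] extends
    from [dom D] to a bounded operator [c]. *)
Definition bounded_commutator D a : Prop :=
  (forall x, dom D x -> dom D (a x)) /\
  exists2 c, bounded_op c &
    forall x y y', graph D (x, y) -> graph D (a x, y') -> c x = y' - a y.

Definition commutator_algebra A D : set (E -> E) :=
  [set a | A a /\ bounded_commutator D a].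

Record is_spectral_triple A D : Prop := IsSpectralTriple {
  compact_inv_one_plus_square :
    exists2 b, bounded_inverse (one_plus_square_graph D) b & compact_op b;
  compact_resolvent : forall z, ~ spectrum D z ->
    exists2 b, bounded_inverse (shift_graph D z) b & compact_op b;
  commutator_subalgebra : subalgebra (commutator_algebra A D) A;
  commutator_dense : A `<=` opclosure (commutator_algebra A D)
}.

End Operators.

Section ClosureSubspace.
Context {R : realType} (V : normedModType R[i]).

Lemma closure_rnormP (S : set V) (x : V) :
  closure S x <-> forall e : R, 0 < e -> exists2 y, S y & rnorm (x - y) < e.
Proof.
split=> [Sx e e0|Sx B /nbhs_ballP[d /= d0 dB]].
  have /Sx[y [Sy]] : nbhs x (ball x (e%:C : R[i])).
    by apply: nbhsx_ballx; rewrite ltcR.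
  by rewrite -ball_normE/= rnorm_lt; exists y.
have dE : (complex.Re d)%:C = d by rewrite RRe_real// gtr0_real.
have /Sx[y Sy xy] : 0 < complex.Re d by rewrite -ltcR dE.
by exists y; split=> //; apply: dB; rewrite -ball_normE/= -dE rnorm_lt.
Qed.

Let pair_real (u : V * V) : (`|u.1| >=< `|u.2|)%O.
Proof. by apply: real_comparable; exact: normr_real. Qed.

Lemma rnorm_fst (u : V * V) : rnorm u.1 <= rnorm u.
Proof. by rewrite -rnorm_le rnormE prod_normE comparable_le_max ?lexx ?pair_real. Qed.

Lemma rnorm_snd (u : V * V) : rnorm u.2 <= rnorm u.
Proof. by rewrite -rnorm_le rnormE prod_normE comparable_le_max ?lexx ?orbT ?pair_real. Qed.

Lemma pair_lin1 (z : R[i]) (u v : V * V) : (z *: u + v).1 = z *: u.1 + v.1.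
Proof. by []. Qed.

Lemma pair_lin2 (z : R[i]) (u v : V * V) : (z *: u + v).2 = z *: u.2 + v.2.
Proof. by []. Qed.

Lemma closure_subspace (S : set V) :
  (forall (z : R[i]) u v, S u -> S v -> S (z *: u + v)) ->
  forall (z : R[i]) u v, closure S u -> closure S v -> closure S (z *: u + v).
Proof.
move=> Slin z u v /closure_rnormP Su /closure_rnormP Sv.
apply/closure_rnormP => e e0.
have z1 : 0 < rnorm z + 1 by rewrite ltr_wpDl// rnorm_ge0.
have [|u' Su' uu'] := Su (e / 2 / (rnorm z + 1)); first by rewrite !divr_gt0.
have [|v' Sv' vv'] := Sv (e / 2); first by rewrite !divr_gt0.
exists (z *: u' + v'); first exact: Slin.
have -> : z *: u + v - (z *: u' + v') = z *: (u - u') + (v - v').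
  by rewrite scalerBr opprD addrACA.
rewrite (le_lt_trans (rnormD _ _))// [ltRHS]splitr ler_ltD// rnormZ.
move: uu'; rewrite ltr_pdivlMr// => /ltW; apply: le_trans.
by rewrite mulrC ler_wpM2l ?rnorm_ge0// lerDl.
Qed.

End ClosureSubspace.

Section Lp.
Context {R : realType} (T : choiceType).
Local Notation C := R[i].
Implicit Types (p : R) (f g : T -> C).

Definition lp_mass p f : \bar R :=
  \esum_(x in [set: T]) ((rnorm (f x)) `^ p)%:E.

Definition lp_pred p : {pred T -> C} := mem [set f | (lp_mass p f < +oo)%E].

Lemma lp_mass_leP p f (M : R) : (lp_mass p f <= M%:E)%E <->
  forall A : {fset T}, \sum_(x <- A) (rnorm (f x)) `^ p <= M.
Proof.
split=> [fM A|fM].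
  rewrite -lee_fin (le_trans _ fM)//; apply: esum_ge.
  exists [set` A]; first by split.
  by rewrite fsbig_finite// set_fsetK sumEFin.
apply: ge_ereal_sup => _ [A [finA _] <-].
by rewrite fsbig_finite// sumEFin lee_fin.
Qed.

Lemma lp_mass_ge0 p f : (0 <= lp_mass p f)%E.
Proof. by apply: esum_ge0 => x _; rewrite lee_fin powR_ge0. Qed.

Lemma lp_predE p f : (f \in lp_pred p) = (lp_mass p f < +oo)%E.
Proof. by apply/idP/idP => [/set_mem|fp]//; exact/mem_set. Qed.

Lemma lp_predP p f : reflect
  (exists M : R, forall A : {fset T}, \sum_(x <- A) (rnorm (f x)) `^ p <= M)
  (f \in lp_pred p).
Proof.
rewrite lp_predE; apply: (iffP idP) => [fp|[M /lp_mass_leP /le_lt_trans]].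
  exists (fine (lp_mass p f)); apply/lp_mass_leP.
  by rewrite fineK// ge0_fin_numE// lp_mass_ge0.
by apply; exact: ltry.
Qed.

(* Minkowski's inequality, in normalized form *)
Lemma lp_sum_minkowski p f g (a b : R) (A : {fset T}) : 1 <= p ->
  0 < a -> 0 < b ->
  \sum_(x <- A) (rnorm (f x)) `^ p <= a `^ p ->
  \sum_(x <- A) (rnorm (g x)) `^ p <= b `^ p ->
  \sum_(x <- A) (rnorm (f x + g x)) `^ p <= (a + b) `^ p.
Proof.
move=> p1 a0 b0 fa gb.
have p0 : 0 <= p by rewrite (le_trans _ p1).
have ab0 : 0 < a + b by rewrite addr_gt0.
pose t := a / (a + b).
have t01 : 0 <= t <= 1.
  by apply/andP; split; [apply: divr_ge0; exact: ltW|
    rewrite ler_pdivrMr// mul1r lerDl ltW].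
have tE : 1 - t = b / (a + b).
  by rewrite /t -[X in X - _](@divff _ (a + b)) ?gt_eqF// -mulrBl addrAC subrr add0r.
have [t0 t1] := andP t01.
have inv_powR c : 0 < c -> c^-1 `^ p = (c `^ p)^-1.
  by move=> c0; rewrite -(powR_inv1 (ltW c0)) -powRrM mulN1r powRN.
have key x : rnorm (f x + g x) `^ p <= (a + b) `^ p *
    (t * ((a `^ p)^-1 * rnorm (f x) `^ p)
     + (1 - t) * ((b `^ p)^-1 * rnorm (g x) `^ p)).
  have fE : (a `^ p)^-1 * rnorm (f x) `^ p = (rnorm (f x) / a) `^ p.
    by rewrite powRM ?rnorm_ge0 ?invr_ge0 ?ltW// mulrC inv_powR.
  have gE : (b `^ p)^-1 * rnorm (g x) `^ p = (rnorm (g x) / b) `^ p.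
    by rewrite powRM ?rnorm_ge0 ?invr_ge0 ?ltW// mulrC inv_powR.
  rewrite fE gE.
  have := @convex_powR R p p1 (Itv01 t0 t1) (rnorm (f x) / a) (rnorm (g x) / b).
  rewrite !inE/= !in_itv/= !andbT !divr_ge0 ?rnorm_ge0 ?(ltW a0) ?(ltW b0)//.
  move=> /(_ isT isT).
  rewrite [X in X `^ _ <= _ -> _]convRE [X in _ <= X -> _]convRE/= /unstable.onem.
  move=> cvx.
  apply: (le_trans _ (ler_wpM2l (powR_ge0 _ _) cvx)).
  rewrite -powRM ?(ltW ab0)//; last first.
    by rewrite addr_ge0// mulr_ge0// ?divr_ge0 ?rnorm_ge0 ?subr_ge0
      ?(ltW a0) ?(ltW b0).
  have -> : (a + b) * (t * (rnorm (f x) / a) + (1 - t) * (rnorm (g x) / b)) =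
            rnorm (f x) + rnorm (g x).
    rewrite tE /t mulrDr; congr (_ + _).
      by rewrite mulrA (mulrC (a + b)) divfK ?gt_eqF// mulrC divfK// gt_eqF.
    by rewrite mulrA (mulrC (a + b)) divfK ?gt_eqF// mulrC divfK// gt_eqF.
  by rewrite ge0_ler_powR ?nnegrE ?rnorm_ge0 ?addr_ge0 ?rnorm_ge0// rnormD.
apply: (le_trans (ler_sum _ (fun x _ => key x))).
rewrite -mulr_sumr -[leRHS]mulr1 ler_wpM2l ?powR_ge0//.
rewrite big_split/= -!mulr_sumr.
rewrite -[leRHS](subrKC t) lerD//.
  by rewrite -[leRHS]mulr1 ler_wpM2l// mulrC ler_pdivrMr ?powR_gt0// mul1r.
by rewrite -[leRHS]mulr1 ler_wpM2l ?subr_ge0// mulrC ler_pdivrMr ?powR_gt0// mul1r.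
Qed.

Lemma lp_pred_submod p : 1 <= p -> submod_closed (lp_pred p).
Proof.
move=> p1; have p0 : 0 < p by rewrite (lt_le_trans _ p1).
split.
  apply/lp_predP; exists 0 => A; rewrite big1// => x _.
  by rewrite rnorm0 powR0// gt_eqF.
move=> z f g /lp_predP[M fM] /lp_predP[N gN].
have bnd (h : T -> C) (K : R) :
    (forall A : {fset T}, \sum_(x <- A) rnorm (h x) `^ p <= K) ->
    forall A : {fset T}, \sum_(x <- A) rnorm (h x) `^ p <=
      ((Num.max 1 K) `^ p^-1) `^ p.
  move=> hK A; rewrite -powRrM mulVf ?gt_eqF// powRr1; last first.
    by rewrite le_max ler01.
  by rewrite (le_trans (hK A))// le_max lexx orbT.
have max0 (K : R) : 0 < (Num.max 1 K) `^ p^-1 by rewrite powR_gt0// lt_max ltr01.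
apply/lp_predP; eexists => A; apply: lp_sum_minkowski p1 (max0 _) (max0 _) _ _.
  apply: (bnd _ (rnorm z `^ p * M)) => B.
  under eq_bigr do rewrite rnormM powRM ?rnorm_ge0//.
  by rewrite -mulr_sumr ler_wpM2l ?powR_ge0.
exact: bnd gN _.
Qed.

Record lp p (p1 : 1 <= p) := Lp { lpfun :> T -> C; lpfunP : lpfun \in lp_pred p }.

HB.instance Definition _ p (p1 : 1 <= p) := [isSub for @lpfun p p1].
HB.instance Definition _ p (p1 : 1 <= p) := [Choice of lp p1 by <:].

End Lp.

(** [lp T p1] is the space of the [f : T -> R[i]] with [sum |f x|^p < oo], with
    its pointwise operations and norm [(sum |f x|^p)^(1/p)]. *)

Section LpNormed.
Context {R : realType} (T : choiceType) (p : R) (p1 : 1 <= p).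
Local Notation C := R[i].
Local Notation lp := (lp T p1).

#[local] HB.instance Definition _ :=
  GRing.isSubmodClosed.Build _ _ (@lp_pred R T p) (lp_pred_submod T p1).

HB.instance Definition _ := [SubChoice_isSubLmodule of lp by <:].

Definition lpnorm (f : lp) : R := (fine (lp_mass p f)) `^ p^-1.

Let p0 : 0 < p. Proof. exact: lt_le_trans p1. Qed.

Lemma lpnorm_leP (f : lp) (a : R) : 0 <= a ->
  lpnorm f <= a <->
  forall A : {fset T}, \sum_(x <- A) (rnorm (f x)) `^ p <= a `^ p.
Proof.
move=> a0; rewrite -lp_mass_leP.
have f0 := lp_mass_ge0 p f.
rewrite -[lp_mass p f]fineK ?ge0_fin_numE -?lp_predE ?lpfunP// lee_fin.
have {}f0 : 0 <= fine (lp_mass p f) by rewrite fine_ge0.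
rewrite /lpnorm; split=> fa.
  rewrite -[leLHS]powRr1// -(@mulVf _ p) ?gt_eqF// powRrM.
  by rewrite ge0_ler_powR ?nnegrE ?powR_ge0// ltW.
rewrite -[leRHS]powRr1// -(@mulfV _ p) ?gt_eqF// powRrM.
by rewrite ge0_ler_powR ?nnegrE ?powR_ge0 ?invr_ge0 ?(ltW p0).
Qed.

Lemma lpnorm_ge0 f : 0 <= lpnorm f.
Proof. exact: powR_ge0. Qed.

Lemma lpnorm_sum (f : lp) (A : {fset T}) :
  \sum_(x <- A) (rnorm (f x)) `^ p <= lpnorm f `^ p.
Proof. by apply/(lpnorm_leP f (lpnorm_ge0 f)) : A. Qed.

Lemma lpnorm_coord (f : lp) x : rnorm (f x) <= lpnorm f.
Proof.
have := lpnorm_sum f [fset x]%fset; rewrite big_seq_fset1 => fx.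
rewrite -[leLHS]powRr1 ?rnorm_ge0// -[leRHS]powRr1 ?lpnorm_ge0//.
rewrite -(@mulfV _ p) ?gt_eqF// 2!powRrM.
by rewrite ge0_ler_powR ?nnegrE ?powR_ge0 ?invr_ge0 ?(ltW p0).
Qed.

Lemma lp_ext (f g : lp) : f =1 g -> f = g.
Proof. by move=> fg; apply/val_inj/funext. Qed.

Lemma lpDE (f g : lp) x : (f + g) x = f x + g x. Proof. by []. Qed.
Lemma lpZE (z : C) (f : lp) x : (z *: f) x = z * f x. Proof. by []. Qed.
Lemma lpNE (f : lp) x : (- f) x = - f x. Proof. by []. Qed.
Lemma lp0E x : (0 : lp) x = 0. Proof. by []. Qed.

Let normC (f : lp) : C := (lpnorm f)%:C.

Let normCD f g : normC (f + g) <= normC f + normC g.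
Proof.
rewrite /normC -rmorphD/= lecR; apply/ler_addgt0Pr => e e0.
have e2 : 0 < e / 2 by rewrite divr_gt0.
have -> : lpnorm f + lpnorm g + e = (lpnorm f + e / 2) + (lpnorm g + e / 2).
  by rewrite addrACA -splitr.
have pos h : 0 < lpnorm h + e / 2 by rewrite ltr_wpDl// lpnorm_ge0.
have bnd (h : lp) A :
    \sum_(x <- enum_fset A) (rnorm (h x)) `^ p <= (lpnorm h + e / 2) `^ p.
  rewrite (le_trans (lpnorm_sum h A))// ge0_ler_powR ?nnegrE ?(ltW p0)//.
  - exact: lpnorm_ge0.
  - exact: ltW (pos h).
  - by rewrite lerDl ltW.
apply/lpnorm_leP => [|A]; first by rewrite ltW// addr_gt0.
exact: lp_sum_minkowski (pos f) (pos g) (bnd _ _) (bnd _ _).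
Qed.

Let lpnormZ_le z f : lpnorm (z *: f) <= rnorm z * lpnorm f.
Proof.
apply/lpnorm_leP => [|A]; first by rewrite mulr_ge0 ?rnorm_ge0 ?lpnorm_ge0.
under eq_bigr do rewrite lpZE rnormM powRM ?rnorm_ge0//.
by rewrite -mulr_sumr powRM ?rnorm_ge0 ?lpnorm_ge0// ler_wpM2l ?powR_ge0// lpnorm_sum.
Qed.

Let lpnorm_eq0 f : lpnorm f = 0 -> f = 0.
Proof.
move=> f0; apply/lp_ext => x; apply: rnorm_eq0; apply/le_anti.
by rewrite rnorm_ge0 -f0 lpnorm_coord.
Qed.

Let normCZ z f : normC (z *: f) = `|z| * normC f.
Proof.
rewrite /normC -rnormE -rmorphM/=; congr (_%:C); apply/le_anti.
rewrite lpnormZ_le/=; have [->|z0] := eqVneq z 0.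
  by rewrite rnorm0 mul0r lpnorm_ge0.
have rz0 : 0 < rnorm z by rewrite lt_def rnorm_ge0 andbT; apply: contra_neq z0; exact: rnorm_eq0.
rewrite -ler_pdivlMl// -[leLHS]/(lpnorm f) -[X in lpnorm X <= _](scalerK z0).
rewrite (le_trans (lpnormZ_le _ _))// ler_wpM2r ?lpnorm_ge0//.
by rewrite -[leRHS]mulr1 ler_pdivlMl// -rnormM mulfV// rnorm1.
Qed.

Let normC_eq0 f : normC f = 0 -> f = 0.
Proof. by move=> /complexI/lpnorm_eq0. Qed.

HB.instance Definition _ := Lmodule_isNormed.Build C lp normCD normCZ normC_eq0.

Lemma lp_rnormE (f : lp) : rnorm f = lpnorm f. Proof. by []. Qed.

End LpNormed.

Section AbsolutelyConvergentSums.
Context {R : realType} (T : choiceType).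
Local Notation C := R[i].

(** Sum of a family of complex numbers: the limit of the net of its finite
    partial sums. *)
Definition csum (f : T -> C) : C := summability.sum (fun x => f x : C^o).

Definition abs_summable (f : T -> C) : Prop :=
  exists M : R, forall A : {fset T}, \sum_(x <- A) rnorm (f x) <= M.

Lemma csum_unique (f : T -> C) (s : C) :
  (forall e : R, 0 < e -> exists A0 : {fset T}, forall A : {fset T},
     (A0 `<=` A)%fset -> rnorm (s - \sum_(x <- A) f x) < e) ->
  csum f = s.
Proof.
move=> fs; have PF := @summability.totally_filter T.
apply: (@norm_cvg_lim _ C^o); apply/cvgrPdist_lt => e e0.
have eE : (complex.Re e)%:C = e by rewrite RRe_real// gtr0_real.
have /fs[A0 fA0] : 0 < complex.Re e by rewrite -ltcR eE.
exists A0 => // A A0A; rewrite -eE rnorm_lt /summability.partial_sum.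
by rewrite -(big_seq_fsetE _ A xpredT f); exact: fA0.
Qed.

Let nneg_sum (g : T -> R) (M : R) : (forall x, 0 <= g x) ->
  (forall A : {fset T}, \sum_(x <- A) g x <= M) ->
  exists s : R, forall e : R, 0 < e -> exists A0 : {fset T},
    forall A : {fset T}, (A0 `<=` A)%fset -> `|s - \sum_(x <- A) g x| < e.
Proof.
move=> g0 gM; pose S := [set \sum_(x <- enum_fset A) g x | A in [set: {fset T}]].
have supS : has_sup S.
  split; first by exists 0, fset0; rewrite // big_seq_fset0.
  by exists M => _ [A _ <-].
exists (sup S) => e e0.
have [_ [A0 _ <-] A0e] := sup_adherent e0 supS.
exists A0 => A A0A; have AS : \sum_(x <- A) g x <= sup S.
  by apply: sup_upper_bound => //; exists A.
rewrite ger0_norm ?subr_ge0// ltrBlDr -ltrBlDl (lt_le_trans A0e)//.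
rewrite (big_fsetID _ (mem A0) A)/=.
have -> : [fset x in A | x \in A0]%fset = A0.
  by apply/fsetP => x; rewrite !inE/= andbC; case: (boolP (x \in A0)) => //= /(fsubsetP A0A).
by rewrite lerDl sumr_ge0.
Qed.

Let real_sum (g : T -> R) (M : R) :
  (forall A : {fset T}, \sum_(x <- A) `|g x| <= M) ->
  exists s : R, forall e : R, 0 < e -> exists A0 : {fset T},
    forall A : {fset T}, (A0 `<=` A)%fset -> `|s - \sum_(x <- A) g x| < e.
Proof.
move=> gM.
have [s1 s1P] := nneg_sum (fun x => normr_ge0 (g x)) gM.
have [|A|s2 s2P] := @nneg_sum (fun x => `|g x| + g x) (M + M).
- by move=> x; rewrite -lerBlDl sub0r lerNnormlW.
- rewrite big_split/= lerD// (le_trans _ (gM A))// ler_sum// => x _.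
  exact: ler_norm.
exists (s2 - s1) => e e0; have e2 : 0 < e / 2 by rewrite divr_gt0.
have [A1 A1P] := s1P _ e2; have [A2 A2P] := s2P _ e2.
exists (A1 `|` A2)%fset => A; rewrite fsubUset => /andP[/A1P h1 /A2P].
rewrite big_split/= => h2.
have -> : s2 - s1 - \sum_(x <- A) g x =
    (s2 - (\sum_(x <- A) `|g x| + \sum_(x <- A) g x)) - (s1 - \sum_(x <- A) `|g x|).
  by ring.
by rewrite (le_lt_trans (ler_normB _ _))// [ltRHS]splitr ltrD.
Qed.

Lemma csumP (f : T -> C) : abs_summable f -> forall e : R, 0 < e ->
  exists A0 : {fset T}, forall A : {fset T}, (A0 `<=` A)%fset ->
    rnorm (csum f - \sum_(x <- A) f x) < e.
Proof.
move=> [M fM].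
have ReM (A : {fset T}) : \sum_(x <- A) `|complex.Re (f x)| <= M.
  by rewrite (le_trans _ (fM A))// ler_sum// => x _; rewrite -lecR rnormE normc_ge_Re.
have ImM (A : {fset T}) : \sum_(x <- A) `|complex.Im (f x)| <= M.
  rewrite (le_trans _ (fM A))// ler_sum// => x _.
  have <- : rnorm (f x * 'i) = rnorm (f x) by rewrite rnormM rnormi mulr1.
  by rewrite -normrN -ReiNIm -lecR rnormE normc_ge_Re.
have [s sP] := real_sum ReM; have [t tP] := real_sum ImM.
suff fst (e : R) : 0 < e -> exists A0 : {fset T}, forall A : {fset T},
    (A0 `<=` A)%fset -> rnorm (s +i* t - \sum_(x <- A) f x) < e.
  by rewrite (csum_unique fst).
move=> e0; have e2 : 0 < e / 2 by rewrite divr_gt0.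
have [A1 A1P] := sP _ e2; have [A2 A2P] := tP _ e2.
exists (A1 `|` A2)%fset => A; rewrite fsubUset => /andP[/A1P h1 /A2P h2].
have -> : s +i* t - \sum_(x <- A) f x =
    (s - \sum_(x <- A) complex.Re (f x))%:C
    + 'i * (t - \sum_(x <- A) complex.Im (f x))%:C.
  rewrite !rmorphB/= !rmorph_sum/= mulrBr addrACA -opprD; congr (_ - _).
    by rewrite [LHS]complexE.
  by rewrite mulr_sumr -big_split/=; apply: eq_bigr => x _; rewrite [LHS]complexE.
rewrite (le_lt_trans (rnormD _ _))// [ltRHS]splitr rnormM !rnormC.
by rewrite rnormi mul1r ltrD.
Qed.

Lemma csum_linear (z : C) (f g : T -> C) : abs_summable f -> abs_summable g ->
  csum (fun x => z * f x + g x) = z * csum f + csum g.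
Proof.
move=> /csumP fP /csumP gP; apply: csum_unique => e e0.
have z1 : 0 < rnorm z + 1 by rewrite ltr_wpDl// rnorm_ge0.
have [|A1 A1P] := fP (e / 2 / (rnorm z + 1)); first by rewrite !divr_gt0.
have [|A2 A2P] := gP (e / 2); first by rewrite !divr_gt0.
exists (A1 `|` A2)%fset => A; rewrite fsubUset => /andP[/A1P h1 /A2P h2].
rewrite big_split/= -mulr_sumr.
have -> : forall a b c d : C, z * a + b - (z * c + d) = z * (a - c) + (b - d).
  by move=> a b c d; rewrite mulrBr opprD addrACA.
rewrite (le_lt_trans (rnormD _ _))// [ltRHS]splitr ler_ltD// rnormM.
move: h1; rewrite ltr_pdivlMr// => /ltW; apply: le_trans.
by rewrite mulrC ler_wpM2l ?rnorm_ge0// lerDl.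
Qed.

End AbsolutelyConvergentSums.

Section Convolution.
Context {R : realType} (G : groupType) (p : R) (p1 : 1 <= p).
Local Notation C := R[i].
Local Notation l1 := (lp G (lexx (1 : R))).
Local Notation lp := (lp G p1).

Definition convolution (f xi : G -> C) : G -> C :=
  fun x => csum (fun y => f y * xi (y^-1 * x)%g).

Let p0 : 0 < p. Proof. exact: lt_le_trans p1. Qed.

Lemma l1_sum (f : l1) (A : {fset G}) : \sum_(x <- A) rnorm (f x) <= rnorm f.
Proof.
have := lpnorm_sum f A; rewrite powRr1 ?lpnorm_ge0//.
by under eq_bigr do rewrite powRr1 ?rnorm_ge0//.
Qed.

Lemma translate_sum (xi : lp) y (A : {fset G}) :
  \sum_(x <- A) rnorm (xi (y^-1 * x)%g) `^ p <= rnorm xi `^ p.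
Proof.
have := lpnorm_sum xi [fset (y^-1 * x)%g | x in A]%fset.
rewrite big_imfset//= => x x' _ _; exact: mulgI.
Qed.

Lemma translate_subproof (xi : lp) y :
  (fun x => xi (y^-1 * x)%g) \in @lp_pred R G p.
Proof. by apply/lp_predP; exists (rnorm xi `^ p) => A; exact: translate_sum. Qed.

Definition translate y (xi : lp) : lp := Lp p1 (translate_subproof xi y).

Lemma rnorm_translate y (xi : lp) : rnorm (translate y xi) <= rnorm xi.
Proof. by apply/(lpnorm_leP (translate y xi) (rnorm_ge0 xi)) => A; exact: translate_sum. Qed.

Lemma convolution_summable (f : l1) (xi : lp) x :
  abs_summable (fun y => f y * xi (y^-1 * x)%g).
Proof.
exists (rnorm f * rnorm xi) => A.
rewrite (@le_trans _ _ (\sum_(y <- A) rnorm (f y) * rnorm xi))//.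
  apply: ler_sum => y _; rewrite rnormM ler_wpM2l ?rnorm_ge0//.
  exact: lpnorm_coord.
by rewrite -mulr_suml ler_wpM2r ?rnorm_ge0// l1_sum.
Qed.

Let partial (f : l1) (xi : lp) (A : {fset G}) : lp :=
  \sum_(y <- A) f y *: translate y xi.

Let partialE f xi A x : partial f xi A x = \sum_(y <- A) f y * xi (y^-1 * x)%g.
Proof. exact: (big_morph (fun h : lp => h x) (fun _ _ => erefl) erefl). Qed.

Let partial_le f xi A : rnorm (partial f xi A) <= rnorm f * rnorm xi.
Proof.
apply: (@le_trans _ _ (\sum_(y <- A) rnorm (f y) * rnorm xi)).
  apply: (big_ind2 (fun (h : lp) r => rnorm h <= r)) => [|h r h' r' hr hr'|y _].
  - by rewrite rnorm0.
  - by rewrite (le_trans (rnormD _ _))// lerD.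
  - rewrite rnormZ; apply: ler_wpM2l; first exact: rnorm_ge0.
    exact: rnorm_translate.
by rewrite -mulr_suml ler_wpM2r ?rnorm_ge0// l1_sum.
Qed.

(* Young's inequality *)
Lemma young (f : l1) (xi : lp) (F : {fset G}) :
  \sum_(x <- F) rnorm (convolution f xi x) `^ p <= (rnorm f * rnorm xi) `^ p.
Proof.
set M := rnorm f * rnorm xi; have M0 : 0 <= M by rewrite mulr_ge0 ?rnorm_ge0.
set s := \sum_(x <- F) _; have s0 : 0 <= s by rewrite sumr_ge0// => x _; rewrite powR_ge0.
suff : s `^ p^-1 <= M.
  move=> sM; rewrite -[leLHS]powRr1// -(@mulVf _ p) ?gt_eqF// powRrM.
  by rewrite ge0_ler_powR ?nnegrE ?powR_ge0// ltW.
apply/ler_addgt0Pr => e e0; have e2 : 0 < e / 2 by rewrite divr_gt0.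
pose n : R := (#|` F|%:R + 1); have n0 : 0 < n by rewrite ltr_wpDl.
pose d := (e / 2) * n^-1 `^ p^-1.
have d0 : 0 < d by rewrite mulr_gt0// powR_gt0// invr_gt0.
have dE : d `^ p = (e / 2) `^ p / n.
  rewrite powRM ?powR_ge0 ?(ltW e2)// -powRrM mulVf ?gt_eqF// powRr1//.
  by rewrite invr_ge0 ltW.
have /choice[A0 A0P] x := csumP (convolution_summable f xi x) d0.
pose A : {fset G} := (\bigcup_(x <- F) A0 x)%fset.
have close x : x \in F -> rnorm (convolution f xi x - partial f xi A x) `^ p <= d `^ p.
  move=> xF; rewrite ge0_ler_powR ?nnegrE ?rnorm_ge0 ?(ltW d0) ?(ltW p0)//.
  by rewrite partialE ltW// A0P//; exact: bigfcup_sup.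
have Me : 0 < M + e / 2 by rewrite ltr_wpDl.
have Me1 : 0 <= M + e by rewrite addr_ge0// ltW.
rewrite -[leRHS]powRr1// -(@mulfV _ p) ?gt_eqF// powRrM.
rewrite ge0_ler_powR ?nnegrE ?powR_ge0 ?invr_ge0 ?(ltW p0)//.
have -> : M + e = M + e / 2 + e / 2 by rewrite -addrA -splitr.
have -> : s = \sum_(x <- F)
    rnorm (partial f xi A x + (convolution f xi x - partial f xi A x)) `^ p.
  by apply: eq_bigr => x _; rewrite subrKC.
apply: lp_sum_minkowski => //.
- apply: le_trans (lpnorm_sum (partial f xi A) F) _.
  rewrite ge0_ler_powR ?nnegrE ?(ltW p0) ?(ltW Me) ?lpnorm_ge0//.
  by apply: le_trans (partial_le f xi A) _; rewrite lerDl ltW.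
- rewrite big_seq; apply: (le_trans (ler_sum _ close)); rewrite -big_seq dE.
  rewrite big_const_seq count_predT iter_addr_0 -[leLHS]mulr_natl mulrCA.
  rewrite -[leRHS]mulr1 ler_wpM2l ?powR_ge0// ler_pdivrMr// mul1r /n.
  by rewrite lerDl.
Qed.

Lemma convolution_subproof (f : l1) (xi : lp) :
  convolution f xi \in @lp_pred R G p.
Proof. by apply/lp_predP; eexists => F; exact: young. Qed.

Definition lambda (f : l1) (xi : lp) : lp := Lp p1 (convolution_subproof f xi).

Lemma lambda_bounded (f : l1) : bounded_op (lambda f).
Proof.
split=> [z xi eta|]; last first.
  exists (rnorm f) => xi; apply/(lpnorm_leP (lambda f xi)) => [|F].
    by rewrite mulr_ge0 ?rnorm_ge0.
  exact: young.
apply/lp_ext => x; rewrite lpDE lpZE -csum_linear//; [|exact: convolution_summable..].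
by congr csum; apply/funext => y; rewrite lpDE lpZE mulrDr mulrCA.
Qed.

Definition reduced_group_algebra : set (lp -> lp) := opclosure (range lambda).

End Convolution.

Arguments reduced_group_algebra {R} G {p} p1.

Section LengthFunction.
Context {R : realType} (G : groupType).

Record length_function (L : G -> R) : Prop := LengthFunction {
  length_ge0 : forall x, 0 <= L x;
  length_eq0 : forall x, L x = 0 <-> x = 1%g;
  length_mul : forall x y, L (x * y)%g <= L x + L y;
  length_inv : forall x, L x^-1%g = L x
}.

Definition proper_length (L : G -> R) : Prop :=
  forall r : R, 0 <= r -> finite_set [set x | L x <= r].

End LengthFunction.

Section MultiplicationOperator.
Context {R : realType} (G : groupType) (p : R) (p1 : 1 <= p) (L : G -> R).
Local Notation C := R[i].
Local Notation lp := (lp G p1).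

Definition Cc : set lp := [set f | finite_set [set x | f x != 0]].

Definition mul_graph_Cc : set (lp * lp) :=
  [set u : lp * lp | Cc u.1 /\ forall x, u.2 x = (L x)%:C * u.1 x].

Lemma mul_graph_Cc_closure (u : lp * lp) :
  closure mul_graph_Cc u -> forall x, u.2 x = (L x)%:C * u.1 x.
Proof.
move=> /closure_rnormP uL x; apply/eqP; rewrite -subr_eq0; apply/eqP.
apply: rnorm_eq0; apply/le_anti; rewrite rnorm_ge0 andbT.
apply/ler_addgt0Pr => e e0; rewrite add0r.
have K0 : 0 < 1 + `|L x| by rewrite ltr_pwDl.
have [|v [_ vL]] := uL (e / (1 + `|L x|)); first by rewrite divr_gt0.
move=> uv; have h1 : rnorm (u.1 - v.1) <= e / (1 + `|L x|).
  exact: le_trans (rnorm_fst (u - v)) (ltW uv).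
have h2 : rnorm (u.2 - v.2) <= e / (1 + `|L x|).
  exact: le_trans (rnorm_snd (u - v)) (ltW uv).
have -> : u.2 x - (L x)%:C * u.1 x =
    (u.2 - v.2) x - (L x)%:C * (u.1 - v.1) x.
  by rewrite !lpDE !lpNE vL; ring.
rewrite (le_trans (rnormD _ _))// rnormN rnormM rnormC.
have -> : e = e / (1 + `|L x|) + `|L x| * (e / (1 + `|L x|)).
  by rewrite -[X in X + _]mul1r -mulrDl mulrC divfK// gt_eqF.
apply: lerD; first exact: le_trans (lpnorm_coord _ _) h2.
by apply: ler_wpM2l => //; exact: le_trans (lpnorm_coord _ _) h1.
Qed.

Let DL_fun x y y' : closure mul_graph_Cc (x, y) -> closure mul_graph_Cc (x, y') ->
  y = y'.
Proof.
move=> /mul_graph_Cc_closure h /mul_graph_Cc_closure h'.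
by apply/lp_ext => g; rewrite (h g) (h' g).
Qed.

Let DL_0 : closure mul_graph_Cc 0.
Proof.
apply: subset_closure; split=> [|x]; last exact/esym/mulr0.
by apply: (@sub_finite_set _ _ set0) => // x /= /eqP[].
Qed.

Let DL_lin (z : C) u v : closure mul_graph_Cc u -> closure mul_graph_Cc v ->
  closure mul_graph_Cc (z *: u + v).
Proof.
apply: closure_subspace => {u v} {}z u v [uc uL] [vc vL]; split=> [|x].
  apply: (@sub_finite_set _ _ ([set x | u.1 x != 0] `|` [set x | v.1 x != 0])).
    move=> x; have [ux|ux] := eqVneq (u.1 x) 0; last by left.
    have [vx|vx] := eqVneq (v.1 x) 0; last by right.
    have e : (z *: u + v).1 x = z * u.1 x + v.1 x by rewrite pair_lin1 lpDE lpZE.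
    by rewrite /mkset e ux vx mulr0 addr0 eqxx.
  by rewrite finite_setU.
by rewrite pair_lin1 pair_lin2 !lpDE !lpZE uL vL mulrDr mulrCA.
Qed.

(** The closure of multiplication by [L] on [C_c(G)]: the closure of its graph
    in [l^p(G) * l^p(G)], which is again the graph of an operator. *)
Definition length_operator : unbounded_op lp :=
  UnboundedOp (graph := closure mul_graph_Cc) DL_fun DL_0 DL_lin.

End MultiplicationOperator.

(* Main.v *)
Require Import Defs.
From mathcomp Require Import all_boot all_order all_algebra finmap.
From mathcomp Require Import all_classical all_reals all_analysis.
From mathcomp Require Import complex ring.

(** [D] is closed multiplication by [L], with domain all [f] such that [L f] is
    in [l^p]. Hence [(I + D^2)^-1] and every resolvent are multiplications by
    functions which, [L] being proper, vanish at infinity. Such an operator is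
    compact because the unit ball of [l^p] is compact for pointwise convergence
    (Tychonoff), where it turns into a norm-continuous map.
    The finite combinations of translations are an algebra, dense in
    [F^p_r(G)], and [|L x - L (y^-1 x)| <= L y] bounds the commutator of [D]
    with the translation by [y]. *)

Set Implicit Arguments.
Unset Strict Implicit.
Unset Printing Implicit Defensive.

Import Order.TTheory GRing.Theory Num.Theory numFieldNormedType.Exports.

Local Open Scope classical_set_scope.
Local Open Scope ring_scope.
Local Open Scope complex_scope.

(** * Bounded operators, the operator norm and norm closures *)

Section OperatorAlgebra.
Context {R : realType} (E : normedModType R[i]).
Implicit Types (a b c : E -> E) (S : set (E -> E)) (D : unbounded_op E).

Lemma opDE a b x : (a + b) x = a x + b x. Proof. by []. Qed.
Lemma opZE (z : R[i]) a x : (z *: a) x = z *: a x. Proof. by []. Qed.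
Lemma op0E x : (0 : E -> E) x = 0. Proof. by []. Qed.

Lemma linear_opD a (x y : E) : linear a -> a (x + y) = a x + a y.
Proof. by move=> al; rewrite -[x]scale1r al !scale1r. Qed.

Lemma linear_op0 a : linear a -> a 0 = 0.
Proof.
by move=> al; apply: (addrI (a 0)); rewrite addr0 -[in RHS](addr0 0) linear_opD.
Qed.

Lemma linear_opZ a (z : R[i]) (x : E) : linear a -> a (z *: x) = z *: a x.
Proof. by move=> al; rewrite -[z *: x]addr0 al linear_op0// addr0. Qed.

Lemma linear_opB a (x y : E) : linear a -> a (x - y) = a x - a y.
Proof. by move=> al; rewrite linear_opD// -(scaleN1r y) linear_opZ// scaleN1r. Qed.

Lemma bounded_opP a : bounded_op a ->
  exists2 M : R, 0 <= M & forall x, rnorm (a x) <= M * rnorm x.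
Proof.
move=> [_ [M aM]]; exists `|M| => // x.
by rewrite (le_trans (aM x))// ler_wpM2r ?rnorm_ge0// ler_norm.
Qed.

Lemma bounded_op0 : bounded_op (0 : E -> E).
Proof.
split=> [z x y|]; first by rewrite !op0E scaler0 addr0.
by exists 0 => x; rewrite mul0r rnorm0.
Qed.

Lemma bounded_opD a b : bounded_op a -> bounded_op b -> bounded_op (a + b).
Proof.
move=> [al [M aM]] [bl [N bN]]; split=> [z x y|].
  by rewrite !opDE al bl scalerDr addrACA.
exists (M + N) => x.
by rewrite opDE mulrDl (le_trans (rnormD _ _))// lerD.
Qed.

Lemma bounded_opZ (z : R[i]) a : bounded_op a -> bounded_op (z *: a).
Proof.
move=> [al [M aM]]; split=> [w x y|].
  by rewrite !opZE al scalerDr !scalerA mulrC.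
exists (rnorm z * M) => x.
by rewrite opZE rnormZ -mulrA ler_wpM2l ?rnorm_ge0.
Qed.

Lemma bounded_opN a : bounded_op a -> bounded_op (- a).
Proof. by rewrite -scaleN1r; exact: bounded_opZ. Qed.

Lemma bounded_op_comp a b : bounded_op a -> bounded_op b -> bounded_op (a \o b).
Proof.
move=> ba [bl [N bN]]; have [M M0 aM] := bounded_opP ba; have [al _] := ba.
split=> [z x y|]; first by rewrite /= bl al.
by exists (M * N) => x; rewrite /= (le_trans (aM _))// -mulrA ler_wpM2l.
Qed.

Lemma opnorm_le a (M : R) : 0 <= M ->
  (forall x, rnorm (a x) <= M * rnorm x) -> opnorm a <= M.
Proof.
move=> M0 aM; apply: ge_sup.
  by exists (rnorm (a 0)), 0 => //; rewrite /= rnorm0.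
move=> _ [x /= x1 <-]; rewrite (le_trans (aM x))//.
by rewrite -[leRHS]mulr1 ler_wpM2l.
Qed.

(** Rescale [x] to norm 1. Boundedness of [a] is what makes the supremum in [opnorm] an upper
    bound. *)
Lemma le_opnorm a x : bounded_op a -> rnorm (a x) <= opnorm a * rnorm x.
Proof.
move=> ba; have [M M0 aM] := bounded_opP ba; have [al _] := ba.
have [->|x0] := eqVneq x 0; first by rewrite linear_op0// rnorm0 mulr0.
have rx : 0 < rnorm x.
  by rewrite lt_def rnorm_ge0 andbT; apply: contra_neq x0; exact: rnorm_eq0.
rewrite -ler_pdivrMr//; apply: sup_upper_bound; last first.
  exists ((rnorm x)^-1%:C *: x); rewrite /= ?linear_opZ// rnormZ rnormC
    ger0_norm ?invr_ge0 ?rnorm_ge0//.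
    by rewrite mulVf ?gt_eqF.
  by rewrite mulrC.
split; first by exists (rnorm (a 0)), 0 => //; rewrite /= rnorm0.
exists M => _ [y /= y1 <-]; rewrite (le_trans (aM y))//.
by rewrite -[leRHS]mulr1 ler_wpM2l.
Qed.

(** Replaces the supremum in [opnorm] by pointwise estimates, which is how all approximations below
    are carried out. *)
Lemma opclosureP S a : S `<=` @bounded_op R E ->
  opclosure S a <-> bounded_op a /\ forall e : R, 0 < e ->
    exists2 b, S b & forall x, rnorm (a x - b x) <= e * rnorm x.
Proof.
move=> Sb; split=> [[ba Sa]|[ba Sa]]; split=> // e e0.
  have [b bS be] := Sa e e0; exists b => // x.
  have -> : a x - b x = (a - b) x by [].
  rewrite (le_trans (le_opnorm _ _))//; last first.
    by rewrite ler_wpM2r ?rnorm_ge0// ltW.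
  by apply: bounded_opD ba (bounded_opN (Sb _ bS)).
(* The pointwise estimate bounds the supremum only weakly, and [opclosure] asks for a strict bound,
   hence the half. *)
have [|b bS be] := Sa (e / 2); first by rewrite divr_gt0.
exists b => //; apply: (@le_lt_trans _ _ (e / 2)).
  by apply: opnorm_le => //; rewrite ltW// divr_gt0.
by rewrite ltr_pdivrMr// ltr_pMr// ltr1n.
Qed.

Lemma opclosure_mono S S' : S `<=` S' -> opclosure S `<=` opclosure S'.
Proof.
move=> SS' a [ba Sa]; split=> // e /Sa[b Sb be].
by exists b => //; exact: SS'.
Qed.

Lemma subset_opclosure S : S `<=` @bounded_op R E -> S `<=` opclosure S.
Proof.
move=> Sb a Sa; apply/(opclosureP _ Sb); split=> [|e e0]; first exact: Sb.
by exists a => // x; rewrite subrr rnorm0 mulr_ge0 ?rnorm_ge0// ltW.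
Qed.

Lemma opclosure_opclosure S : S `<=` @bounded_op R E ->
  opclosure (opclosure S) `<=` opclosure S.
Proof.
move=> Sb a; have cb : opclosure S `<=` @bounded_op R E by move=> b [].
move=> /(opclosureP _ cb)[ba Sa]; apply/(opclosureP _ Sb); split=> // e e0.
have e2 : 0 < e / 2 by rewrite divr_gt0.
have [b /(opclosureP _ Sb)[_ bS] ab] := Sa _ e2.
have [c Sc bc] := bS _ e2; exists c => // x.
rewrite -(subrKA (b x)) (le_trans (rnormD _ _))// [e]splitr mulrDl.
exact: lerD.
Qed.

(** * Algebraic operations on a norm closure *)

Section SubalgebraClosure.
Context (S : set (E -> E)) (Sb : S `<=` @bounded_op R E).

Lemma opclosureD a b : (forall a b, S a -> S b -> S (a + b)) ->
  opclosure S a -> opclosure S b -> opclosure S (a + b).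
Proof.
move=> SD /(opclosureP _ Sb)[ba Sa] /(opclosureP _ Sb)[bb Sb'].
apply/(opclosureP _ Sb); split=> [|e e0]; first exact: bounded_opD.
have e2 : 0 < e / 2 by rewrite divr_gt0.
have [a' Sa' aa'] := Sa _ e2; have [b' Sb'' bb'] := Sb' _ e2.
exists (a' + b') => [|x]; first exact: SD.
rewrite !opDE opprD addrACA (le_trans (rnormD _ _))// [e]splitr mulrDl.
exact: lerD.
Qed.

Lemma opclosureZ (z : R[i]) a : (forall a, S a -> S (z *: a)) ->
  opclosure S a -> opclosure S (z *: a).
Proof.
move=> SZ /(opclosureP _ Sb)[ba Sa].
apply/(opclosureP _ Sb); split=> [|e e0]; first exact: bounded_opZ.
have z1 : 0 < rnorm z + 1 by rewrite ltr_wpDl// rnorm_ge0.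
have [|a' Sa' aa'] := Sa (e / (rnorm z + 1)); first by rewrite divr_gt0.
exists (z *: a') => [|x]; first exact: SZ.
rewrite !opZE -scalerBr rnormZ.
apply: (le_trans (ler_wpM2l (rnorm_ge0 _) (aa' x))).
rewrite mulrA ler_wpM2r ?rnorm_ge0// mulrCA -[leRHS]mulr1.
by rewrite ler_wpM2l ?(ltW e0)// ler_pdivrMr// mul1r lerDl.
Qed.

(* [a b - a' b' = a (b - b') + (a - a') b'] with [|b'| <= |b| + 1]. *)
Lemma opclosure_comp a b : (forall a b, S a -> S b -> S (a \o b)) ->
  opclosure S a -> opclosure S b -> opclosure S (a \o b).
Proof.
move=> SC /(opclosureP _ Sb)[ba Sa] /(opclosureP _ Sb)[bb Sb'].
apply/(opclosureP _ Sb); split=> [|e e0]; first exact: bounded_op_comp.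
have [M M0 aM] := bounded_opP ba; have [N N0 bN] := bounded_opP bb.
have M1 : 0 < M + 1 by rewrite ltr_wpDl.
have N1 : 0 < N + 1 by rewrite ltr_wpDl.
have [|a' Sa' aa'] := Sa (e / 2 / (N + 1)); first by rewrite !divr_gt0.
have d0 : 0 < Num.min 1 (e / 2 / (M + 1)) by rewrite lt_min ltr01 !divr_gt0.
have [b' Sb'' bb'] := Sb' _ d0.
exists (a' \o b') => [|x]; first exact: SC.
have [al _] := ba; have [a'l _] := Sb Sa'.
have -> : (a \o b) x - (a' \o b') x = a (b x - b' x) + (a (b' x) - a' (b' x)).
  by rewrite (linear_opB _ _ al) subrKA.
rewrite (le_trans (rnormD _ _))// [e]splitr mulrDl; apply: lerD.
  rewrite (le_trans (aM _))//.
  apply: (le_trans (ler_wpM2l M0 (bb' x))).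
  rewrite mulrA ler_wpM2r ?rnorm_ge0//.
  apply: (@le_trans _ _ (M * (e / 2 / (M + 1)))).
    by rewrite ler_wpM2l// ge_min lexx orbT.
  rewrite mulrCA -[leRHS]mulr1 ler_wpM2l ?divr_ge0 ?(ltW e0)//.
  by rewrite ler_pdivrMr// mul1r lerDl.
rewrite (le_trans (aa' _))// -mulrA ler_wpM2l ?divr_ge0 ?(ltW e0)//.
rewrite ler_pdivrMl// mulrDl mul1r -[b' x](subKr (b x)).
rewrite (le_trans (rnormD _ _))// rnormN lerD//.
rewrite (le_trans (bb' x))// -[leRHS]mul1r ler_wpM2r ?rnorm_ge0//.
by rewrite ge_min lexx.
Qed.

End SubalgebraClosure.

(** * Operators with bounded commutator form an algebra *)

Lemma graphD D (u v : E * E) : graph D u -> graph D v -> graph D (u + v).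
Proof. by move=> Du Dv; rewrite -[u]scale1r; exact: graph_lin. Qed.

Lemma graphZ D (z : R[i]) (u : E * E) : graph D u -> graph D (z *: u).
Proof.
by move=> Du; rewrite -[z *: u]addr0; apply: graph_lin => //; exact: graph0.
Qed.

Lemma bounded_commutator0 D : bounded_commutator D (0 : E -> E).
Proof.
split=> [x _|]; first by exists 0; exact: graph0.
exists 0 => [|x y y' _ D0y']; first exact: bounded_op0.
by rewrite (graph_fun D0y' (graph0 D)) subrr.
Qed.

Lemma bounded_commutatorD D a b : bounded_commutator D a ->
  bounded_commutator D b -> bounded_commutator D (a + b).
Proof.
move=> [domA [ca bca caE]] [domB [cb bcb cbE]]; split.
  move=> x Dx; have [y Dy] := domA _ Dx; have [w Dw] := domB _ Dx.
  by exists (y + w); exact: (graphD Dy Dw).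
exists (ca + cb) => [|x y y' Dxy Dy']; first exact: bounded_opD.
have [v Dv] := domA _ (ex_intro _ y Dxy).
have [w Dw] := domB _ (ex_intro _ y Dxy).
(* The graph is single-valued, so the given image [y'] of [(a + b) x] is the sum of the images [v]
   of [a x] and [w] of [b x]. *)
rewrite (graph_fun Dy' (graphD Dv Dw)) !fctE/=.
by rewrite (caE _ _ _ Dxy Dv) (cbE _ _ _ Dxy Dw) opprD addrACA.
Qed.

Lemma bounded_commutatorZ D (z : R[i]) a : bounded_commutator D a ->
  bounded_commutator D (z *: a).
Proof.
move=> [domA [ca bca caE]]; split.
  move=> x Dx; have [y Dy] := domA _ Dx.
  by exists (z *: y); exact: (graphZ z Dy).
exists (z *: ca) => [|x y y' Dxy Dy']; first exact: bounded_opZ.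
have [v Dv] := domA _ (ex_intro _ y Dxy).
rewrite (graph_fun Dy' (graphZ z Dv)) !fctE/=.
by rewrite (caE _ _ _ Dxy Dv) scalerBr.
Qed.

(* The Leibniz rule [[D, a b] = [D, a] b + a [D, b]]. *)
Lemma bounded_commutator_comp D a b : bounded_op a -> bounded_op b ->
  bounded_commutator D a -> bounded_commutator D b ->
  bounded_commutator D (a \o b).
Proof.
move=> ba bb [domA [ca bca caE]] [domB [cb bcb cbE]]; split.
  by move=> x /domB /domA.
exists ((ca \o b) + (a \o cb)) => [|x y y' Dxy Dy'].
  by apply: bounded_opD; exact: bounded_op_comp.
have [w Dw] := domB _ (ex_intro _ y Dxy).
rewrite opDE /= (cbE _ _ _ Dxy Dw) (caE _ _ _ Dw Dy').
have [al _] := ba.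
by rewrite (linear_opB _ _ al) subrKA.
Qed.

Lemma commutator_algebra_subalgebra (A : set (E -> E)) D :
  A `<=` @bounded_op R E -> subalgebra A A ->
  subalgebra (commutator_algebra A D) A.
Proof.
move=> Ab [_ A0 AD AZ AC]; split=> [a []//||a b|z a|a b].
- by split=> //; exact: bounded_commutator0.
- by move=> [Aa ca] [Ab' cb]; split; [exact: AD|exact: bounded_commutatorD].
- by move=> [Aa ca]; split; [exact: AZ|exact: bounded_commutatorZ].
- move=> [Aa ca] [Ab' cb]; split; first exact: AC.
  by apply: bounded_commutator_comp => //; exact: Ab.
Qed.

End OperatorAlgebra.

(** * Finite truncations in [lp] and multiplication by bounded functions *)

Section LpTruncation.
Context {R : realType} (T : choiceType) (p : R) (p1 : 1 <= p).
Local Notation C := R[i].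
Local Notation lp := (lp T p1).
Implicit Types (f g : lp) (h : T -> C) (A : {fset T}).

Let p0 : 0 < p. Proof. exact: lt_le_trans p1. Qed.

Lemma lp_sumE (I : Type) (r : seq I) (F : I -> lp) x :
  (\sum_(i <- r) F i) x = \sum_(i <- r) F i x.
Proof. exact: (big_morph (fun f : lp => f x) (fun _ _ => erefl) erefl). Qed.

(** No sign of [M] is assumed: if [g] is nonzero somewhere, the hypothesis at that point forces
    [0 <= M]; if [g = 0], then [f = 0]. *)
Lemma rnorm_lp_le (M : R) f g :
  (forall x, rnorm (f x) <= M * rnorm (g x)) -> rnorm f <= M * rnorm g.
Proof.
have [->|/eqP g0] := pselect (g = 0).
  move=> fM; rewrite (_ : f = 0) ?rnorm0 ?mulr0//; apply/lp_ext => x.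
  apply/rnorm_eq0/le_anti; rewrite rnorm_ge0 andbT.
  by rewrite (le_trans (fM x))// lp0E rnorm0 mulr0.
move=> fM; have M0 : 0 <= M.
  have [x gx] : exists x, g x != 0.
    apply/not_existsP => gx; move/eqP: g0; apply; apply/lp_ext => x.
    by apply/eqP/negPn/negP; exact: gx.
  have rx : 0 < rnorm (g x).
    by rewrite lt_def rnorm_ge0 andbT; apply: contra_neq gx; exact: rnorm_eq0.
  by rewrite -(pmulr_lge0 _ rx); exact: le_trans (rnorm_ge0 _) (fM x).
apply/lpnorm_leP => [|A]; first by rewrite mulr_ge0 ?rnorm_ge0.
rewrite powRM ?rnorm_ge0//.
apply: (le_trans _ (ler_wpM2l (powR_ge0 _ _) (lpnorm_sum g A))).
rewrite mulr_sumr; apply: ler_sum => x _; rewrite -powRM ?rnorm_ge0//.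
by rewrite ge0_ler_powR ?nnegrE ?mulr_ge0 ?rnorm_ge0 ?(ltW p0).
Qed.

Lemma delta_sum (y : T) A : \sum_(x <- A) rnorm ((x == y)%:R : C) `^ p <= 1.
Proof.
have z x : x != y -> rnorm ((x == y)%:R : C) `^ p = 0.
  by move=> /negPf ->; rewrite rnorm0 powR0// gt_eqF.
have [yA|yA] := boolP (y \in A).
  rewrite (big_fsetD1 y)//= eqxx rnorm1 powR1 big1_seq ?addr0// => x.
  by rewrite !inE => /andP[_ /andP[/z]].
rewrite big1_seq ?ler01// => x /andP[_ xA]; apply: z.
by apply: contraNneq yA => <-.
Qed.

Lemma delta_subproof (y : T) : (fun x => (x == y)%:R) \in @lp_pred R T p.
Proof. by apply/lp_predP; exists 1; exact: delta_sum. Qed.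

Definition delta (y : T) : lp := Lp p1 (delta_subproof y).

Lemma rnorm_delta y : rnorm (delta y) <= 1.
Proof. by apply/(lpnorm_leP (delta y) ler01) => A; rewrite powR1 delta_sum. Qed.

(** Here [h] is an arbitrary function, so that truncation makes sense on the product space before
    membership in [lp] is known. *)
Definition trunc A h : lp := \sum_(x <- A) h x *: delta x.

Lemma truncE A h x : trunc A h x = if x \in A then h x else 0.
Proof.
rewrite /trunc lp_sumE.
have dE y : (h y *: delta y) x = if x == y then h y else 0.
  by rewrite lpZE /=; case: ifP; rewrite ?mulr1 ?mulr0.
under eq_bigr do rewrite dE.
have [xA|xA] := boolP (x \in A).
  rewrite (big_fsetD1 x) ?xA//= eqxx big1_seq ?addr0// => y.
  by rewrite !inE => /andP[_ /andP[yx _]]; rewrite eq_sym (negPf yx).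
rewrite big1_seq// => y /andP[_ yA]; case: eqP => // xy.
by rewrite xy yA in xA.
Qed.

Lemma truncB A h h' : trunc A h - trunc A h' = trunc A (fun x => h x - h' x).
Proof.
by apply/lp_ext => x; rewrite lpDE lpNE !truncE; case: ifP; rewrite ?subr0.
Qed.

Lemma rnorm_trunc_le A h : rnorm (trunc A h) <= \sum_(x <- A) rnorm (h x).
Proof.
apply: (big_ind2 (fun (f : lp) r => rnorm f <= r)) => [|f r g s fr gs|x _].
- by rewrite rnorm0.
- by rewrite (le_trans (rnormD _ _))// lerD.
- by rewrite rnormZ -[leRHS]mulr1 ler_wpM2l ?rnorm_ge0 ?rnorm_delta.
Qed.

Lemma trunc_sum A h :
  \sum_(x <- A) rnorm (trunc A h x) `^ p = \sum_(x <- A) rnorm (h x) `^ p.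
Proof. by apply: eq_big_seq => x xA; rewrite truncE xA. Qed.

(** Describes a ball by conditions that each involve finitely many coordinates; this is what makes
    the unit ball closed for pointwise convergence. *)
Lemma rnorm_trunc_leP f (r : R) : 0 <= r ->
  rnorm f <= r <-> forall A, rnorm (trunc A f) <= r.
Proof.
move=> r0; split=> [fr A|fr].
  have fA : rnorm (trunc A f) <= 1 * rnorm f.
    apply: rnorm_lp_le => x; rewrite mul1r truncE; case: ifP => // _.
    by rewrite rnorm0 rnorm_ge0.
  rewrite mul1r in fA.
  exact: le_trans fA fr.
apply/lpnorm_leP => // A; rewrite -trunc_sum.
exact: (proj1 (lpnorm_leP (trunc A f) r0) (fr A)).
Qed.

Lemma lp_pred_trunc h (r : R) :
  (forall A, rnorm (trunc A h) <= r) -> h \in @lp_pred R T p.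
Proof.
move=> hr; apply/lp_predP; exists (r `^ p) => A; rewrite -trunc_sum.
have r0 : 0 <= r := le_trans (rnorm_ge0 _) (hr A).
exact: (proj1 (lpnorm_leP (trunc A h) r0) (hr A)).
Qed.

(** Choose [A0] whose partial sum of [|f|^p] is within [e^p] of the supremum: any finite sum off
    [A0] is then at most [e^p]. *)
Lemma lp_tail f (e : R) : 0 < e -> exists A0 : {fset T}, forall A,
  (A0 `<=` A)%fset -> rnorm (f - trunc A f) <= e.
Proof.
move=> e0.
pose S := [set \sum_(x <- enum_fset A) rnorm (f x) `^ p | A in [set: {fset T}]].
have supS : has_sup S.
  split; first by exists 0, fset0; rewrite // big_seq_fset0.
  by exists (lpnorm f `^ p) => _ [A _ <-]; exact: lpnorm_sum.
have ep0 : 0 < e `^ p by rewrite powR_gt0.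
have [_ [A0 _ <-] A0e] := sup_adherent ep0 supS.
exists A0 => A A0A; set g := f - trunc A f.
have gE x : g x = if x \in A then 0 else f x.
  by rewrite lpDE lpNE truncE; case: ifP; rewrite ?subrr ?subr0.
clearbody g; apply/lpnorm_leP => [|B]; first exact: ltW.
(* Cancelling the sum over [A0] leaves at most [e^p] for the points of [B] outside [A0], and these
   carry the whole sum of [g] over [B]. *)
have SU : \sum_(x <- (A0 `|` B)%fset) rnorm (f x) `^ p <= sup S.
  by apply: sup_upper_bound => //; exists (A0 `|` B)%fset.
move: A0e; rewrite ltrBlDl => /ltW /(le_trans SU).
rewrite (big_fsetID _ (mem A0) (A0 `|` B)%fset)/=.
have -> : [fset x in (A0 `|` B)%fset | x \in A0]%fset = A0.
  by apply/fsetP => x; rewrite !inE/=; case: (x \in A0); rewrite ?andbF.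
rewrite addrC lerD2r; apply: le_trans.
rewrite [leLHS](big_fsetID _ (mem A0) B)/= big1_seq ?add0r; last first.
  move=> x; rewrite !inE/= => /andP[_ /(fsubsetP A0A) xA].
  by rewrite gE xA rnorm0 powR0// gt_eqF.
have -> : [fset x in (A0 `|` B)%fset | x \notin A0]%fset =
          [fset x in B | x \notin A0]%fset.
  by apply/fsetP => x; rewrite !inE/=; case: (x \in A0); rewrite ?andbF.
apply: ler_sum => x _; rewrite ge0_ler_powR ?nnegrE ?rnorm_ge0 ?(ltW p0)//.
by rewrite gE; case: ifP; rewrite ?rnorm0 ?rnorm_ge0.
Qed.

Lemma bounded_op_mul (m : T -> C) (M : R) (b : lp -> lp) :
  (forall x, rnorm (m x) <= M) -> (forall f x, b f x = m x * f x) ->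
  bounded_op b.
Proof.
move=> mM bE; split=> [z f g|].
  by apply/lp_ext => x; rewrite lpDE lpZE !bE lpDE lpZE mulrDr mulrCA.
exists M => f; apply: rnorm_lp_le => x.
by rewrite bE rnormM ler_wpM2r ?rnorm_ge0.
Qed.

Lemma mul_op_exists (m : T -> C) (M : R) : (forall x, rnorm (m x) <= M) ->
  exists b : lp -> lp, forall f x, b f x = m x * f x.
Proof.
move=> mM; suff mf f : (fun x => m x * f x) \in @lp_pred R T p.
  by exists (fun f => Lp p1 (mf f)).
apply/lp_predP; exists (M `^ p * lpnorm f `^ p) => A.
apply: (le_trans _ (ler_wpM2l (powR_ge0 _ _) (lpnorm_sum f A))).
rewrite mulr_sumr; apply: ler_sum => x _.
have M0 : 0 <= M := le_trans (rnorm_ge0 _) (mM x).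
rewrite -powRM ?rnorm_ge0// rnormM.
by rewrite ge0_ler_powR ?nnegrE ?mulr_ge0 ?rnorm_ge0 ?(ltW p0)// ler_wpM2r ?rnorm_ge0.
Qed.

End LpTruncation.

(** * Multiplication by a function vanishing at infinity is compact *)

Section CompactMultiplication.
Context {R : realType}.
Local Notation C := R[i].

(** The disc of radius [r] lies in a square, the continuous image of a product of two real
    segments. *)
Lemma compact_complex_square (r : R) : exists2 B : set C^o, compact B &
  [set z | rnorm z <= r] `<=` B.
Proof.
pose f (u : R * R) : C^o := u.1 +i* u.2.
exists (f @` (`[- r, r] `*` `[- r, r])); last first.
  move=> [a b] /= abr; exists (a, b) => //=; rewrite !in_itv/= -!ler_norml.
  have ra : `|a| <= rnorm (a +i* b : C).
    by have := normc_ge_Re (a +i* b : C); rewrite -rnormE lecR.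
  have rb : `|b| <= rnorm (a +i* b : C).
    have := normc_ge_Re ((a +i* b : C) * 'i).
    by rewrite -rnormE lecR rnormM rnormi mulr1 ReiNIm normrN.
  by split; [exact: le_trans ra abr|exact: le_trans rb abr].
apply: continuous_compact; last first.
  by apply: compact_setX; exact: segment_compact.
apply: continuous_subspaceT => u; apply/cvgrPdist_lt => e e0.
have eE : (complex.Re e)%:C = e by rewrite RRe_real// gtr0_real.
have e2 : 0 < complex.Re e / 2 by rewrite divr_gt0// -ltcR eE.
have : \forall v \near u, `|u.1 - v.1| < complex.Re e / 2.
  exact: cvgr_dist_lt (@cvg_fst _ _ _ _ _) _ e2.
have : \forall v \near u, `|u.2 - v.2| < complex.Re e / 2.
  exact: cvgr_dist_lt (@cvg_snd _ _ _ _ _) _ e2.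
apply: filterS2 => v h2 h1; rewrite -eE rnorm_lt.
have -> : f u - f v = (u.1 - v.1)%:C + 'i * (u.2 - v.2)%:C.
  by rewrite [LHS]complexE.
by rewrite (le_lt_trans (rnormD _ _))// [ltRHS]splitr rnormM !rnormC rnormi mul1r ltrD.
Qed.

Context (T : choiceType) (p : R) (p1 : 1 <= p).
Local Notation lp := (lp T p1).
Local Notation X := (prod_topology (fun _ : T => C^o)).

(** The unit ball of [lp], seen inside the space [X] of all functions with the topology of pointwise
    convergence. *)
Let ball1 : set X := [set h | forall A, rnorm (trunc p1 A h) <= 1].

Let near_coord (h : X) (A : {fset T}) (d : R) : 0 < d ->
  \forall h' \near h, forall x, x \in A -> rnorm (h x - h' x) <= d.
Proof.
move=> d0; have near1 x : \forall h' \near h, rnorm (h x - h' x) <= d.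
  have dC : 0 < d%:C :> C by rewrite ltcR.
  have hx : (fun h' : X => h' x) @ nbhs h --> nbhs (h x : C^o).
    exact: (@proj_continuous T (fun _ => C^o) x h).
  have := @cvgr_dist_le _ _ X (nbhs h) (nbhs_filter h) _ _ hx _ dC.
  by apply: (@filterS X (nbhs h) (nbhs_filter h)) => h'; rewrite /= rnorm_le.
rewrite -[mem A]/(mem (enum_fset A)).
elim: (enum_fset A) => [|y s ih]; first by apply: (@filterE X (nbhs h) (nbhs_filter h)).
move: (near1 y) ih; apply: (@filterS2 X (nbhs h) (nbhs_filter h)) => h' hy hs x.
by rewrite inE => /orP[/eqP ->|/hs].
Qed.

Let ball1_closed : closed ball1.
Proof.
move=> h clh A; apply/ler_addgt0Pr => e e0.
(* Errors of at most [e / n] at the points of [A] add up to at most [e]; the added 1 keeps [n]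
   positive when [A] is empty. *)
pose n : R := #|` A|%:R + 1; have n0 : 0 < n by rewrite ltr_wpDl.
have [h' [h'1 hh']] := clh _ (near_coord h A (divr_gt0 e0 n0)).
rewrite -[trunc _ _ _](subrK (trunc p1 A h')) truncB.
apply: le_trans (rnormD _ _) _; rewrite addrC; apply: lerD; first exact: h'1.
apply: le_trans (rnorm_trunc_le _ _ _) _.
apply: (@le_trans _ _ (\sum_(x <- A) e / n)).
  by rewrite big_seq [leRHS]big_seq; apply: ler_sum => x; exact: hh'.
rewrite big_const_seq count_predT iter_addr_0 -[leLHS]mulr_natl mulrCA.
by rewrite -[leRHS]mulr1 ler_wpM2l ?(ltW e0)// ler_pdivrMr// mul1r lerDl.
Qed.

(** A closed subset of a product of compact sets: truncation to the single point [x] bounds the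
    coordinate at [x] by 1. *)
Let ball1_compact : compact ball1.
Proof.
have [B Bc rB] := compact_complex_square 1.
apply: (subclosed_compact ball1_closed (tychonoff (fun _ : T => Bc))) => h h1 x.
apply: rB => /=; have := h1 [fset x]%fset.
apply: le_trans; apply: le_trans (lpnorm_coord _ x).
by rewrite truncE inE eqxx.
Qed.

(** On the unit ball [b] is continuous from pointwise convergence to the norm: finitely many
    coordinates are controlled by pointwise closeness, the others by the smallness of [m]. The image
    of the ball is therefore compact. *)
Lemma compact_op_mul (m : T -> C) (b : lp -> lp) : bounded_op b ->
  (forall f x, b f x = m x * f x) ->
  (forall e : R, 0 < e -> exists A : {fset T},
    forall x, x \notin A -> rnorm (m x) <= e) ->
  compact_op b.
Proof.
move=> bb bE mc; split=> //; have [bl _] := bb.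
(* The default 0, taken when [h] is not in [lp], never occurs on [ball1]. *)
pose F (h : X) : lp := b (insubd (0 : lp) h).
suff -> : b @` [set f | rnorm f <= 1] = F @` ball1.
  apply: compact_precompact; first exact: norm_hausdorff.
  apply: continuous_compact ball1_compact.
  apply/subspace_continuousP => h h1; apply/cvgrPdist_le => e e0.
  have eE : (complex.Re e)%:C = e by rewrite RRe_real// gtr0_real.
  move: e0; rewrite -eE ltcR; set d := complex.Re e => d0.
  have d4 : 0 < d / 4 by rewrite divr_gt0.
  have [A mA] := mc _ d4.
  have [N N0 bN] := bounded_opP bb.
  pose n : R := #|` A|%:R + 1; have n0 : 0 < n by rewrite ltr_wpDl.
  have N1 : 0 < N + 1 by rewrite ltr_wpDl.
  (* Coordinate errors of this size on [A] give a truncated difference [t] of norm at most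
     [d / 2 / (N + 1)], hence [b t] of norm at most [d / 2]. *)
  have c0 : 0 < d / 2 / (N + 1) / n by rewrite !divr_gt0.
  have := near_coord h A c0.
  apply: (@filterS X (nbhs h) (nbhs_filter h)) => h' hh' h'1; rewrite rnorm_le.
  have PE g : ball1 g -> (insubd (0 : lp) g : T -> C) = g.
    by move=> /lp_pred_trunc; exact: insubdK.
  pose f := insubd (0 : lp) h; pose f' := insubd (0 : lp) h'.
  have fE : (f : T -> C) = h by exact: PE.
  have f'E : (f' : T -> C) = h' by exact: PE.
  have f1 : rnorm f <= 1 by apply/(rnorm_trunc_leP f ler01) => B; rewrite fE; exact: h1.
  have f'1 : rnorm f' <= 1.
    by apply/(rnorm_trunc_leP f' ler01) => B; rewrite f'E; exact: h'1.
  pose t := trunc p1 A (fun x => h x - h' x).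
  have -> : F h - F h' = b t + b (f - f' - t).
    by rewrite -(linear_opD _ _ bl) [t + _]addrC subrK (linear_opB _ _ bl).
  apply: le_trans (rnormD _ _) _; rewrite [leRHS]splitr; apply: lerD.
    apply: le_trans (bN _) _.
    apply: (@le_trans _ _ (N * (d / 2 / (N + 1)))).
      apply: ler_wpM2l => //; apply: le_trans (rnorm_trunc_le _ _ _) _.
      apply: (@le_trans _ _ (\sum_(x <- A) d / 2 / (N + 1) / n)).
        by rewrite big_seq [leRHS]big_seq; apply: ler_sum => x; exact: hh'.
      rewrite big_const_seq count_predT iter_addr_0 -[leLHS]mulr_natl mulrCA.
      rewrite -[leRHS]mulr1 ler_wpM2l ?divr_ge0 ?(ltW d0) ?(ltW N1)//.
      by rewrite ler_pdivrMr// mul1r lerDl.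
    rewrite mulrCA -[leRHS]mulr1 ler_wpM2l ?divr_ge0 ?(ltW d0)//.
    by rewrite ler_pdivrMr// mul1r lerDl.
  (* The remainder [f - f' - t] vanishes on [A], and off [A] the multiplier is at most [d / 4]; as
     [f] and [f'] lie in the unit ball, [f - f'] has norm at most 2. *)
  apply: (@le_trans _ _ (d / 4 * rnorm (f - f'))); last first.
    have -> : d / 2 = d / 4 * 2 by field.
    apply: ler_wpM2l; first exact: ltW.
    apply: le_trans (rnormD _ _) _; rewrite rnormN.
    have -> : 2 = 1 + 1 :> R by [].
    exact: (lerD f1 f'1).
  apply: rnorm_lp_le => x; rewrite bE rnormM lpDE lpNE truncE.
  have -> : (f - f') x = h x - h' x by rewrite lpDE lpNE fE f'E.
  case: (boolP (x \in A)) => [_|/mA mx]; last first.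
    by rewrite subr0 ler_wpM2r ?rnorm_ge0.
  by rewrite subrr rnorm0 mulr0 mulr_ge0 ?rnorm_ge0 ?(ltW d4).
apply/seteqP; split=> [_ [f /= f1 <-]|_ [h h1 <-]].
  exists (lpfun f); first exact: (proj1 (rnorm_trunc_leP f ler01) f1).
  by rewrite /F valKd.
exists (insubd (0 : lp) h) => //=.
apply/(rnorm_trunc_leP _ ler01) => A.
have hE : (insubd (0 : lp) h : T -> C) = h.
  by apply: insubdK; exact: lp_pred_trunc h1.
by rewrite hE; exact: h1.
Qed.

End CompactMultiplication.

(** * Finite combinations of translations and their closure *)

Section TranslateSpan.
Context {R : realType} (G : groupType) (p : R) (p1 : 1 <= p).
Local Notation C := R[i].
Local Notation l1 := (lp G (lexx (1 : R))).
Local Notation lp := (lp G p1).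

Lemma bounded_op_translate (y : G) : bounded_op (@translate R G p p1 y).
Proof.
split=> [z f g|]; first exact: lp_ext.
by exists 1 => f; rewrite mul1r; exact: rnorm_translate.
Qed.

Lemma translate_translate (y y' : G) (f : lp) :
  translate y (translate y' f) = translate (y * y')%g f.
Proof. by apply/lp_ext => x /=; rewrite invgM mulgA. Qed.

(** This is the image of [C_c(G)] under [lambda]. Building it one term at a time makes every closure
    property an induction. *)
Inductive translate_span : set (lp -> lp) :=
| translate_span0 : translate_span 0
| translate_span_cons (z : C) (y : G) a :
    translate_span a -> translate_span (z *: translate (p1 := p1) y + a).

Lemma bounded_op_translate_span : translate_span `<=` @bounded_op R lp.
Proof.
move=> a; elim=> [|z y {}a _ ba]; first exact: bounded_op0.
by apply: bounded_opD ba; apply/bounded_opZ/bounded_op_translate.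
Qed.

Lemma translate_spanD a b : translate_span a -> translate_span b ->
  translate_span (a + b).
Proof.
move=> + bW; elim=> [|z y {}a _ abW]; first by rewrite add0r.
by rewrite -addrA; exact: translate_span_cons.
Qed.

Lemma translate_spanZ (z : C) a : translate_span a -> translate_span (z *: a).
Proof.
elim=> [|w y {}a _ aW]; first by rewrite scaler0; exact: translate_span0.
by rewrite scalerDr scalerA; exact: translate_span_cons.
Qed.

(** Induction on [a] reduces to a single translation composed with [b]; induction on [b] then
    reduces to [translate_translate]. *)
Lemma translate_span_comp a b : translate_span a -> translate_span b ->
  translate_span (a \o b).
Proof.
move=> + bW; elim=> [|z y {}a _ abW]; first exact: translate_span0.
have ybW : translate_span (translate (p1 := p1) y \o b).
  elim: bW => [|w y' b' _ b'W].
    have -> : translate (p1 := p1) y \o (0 : lp -> lp) = 0.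
      by apply/funext => f; exact: lp_ext.
    exact: translate_span0.
  have -> : translate (p1 := p1) y \o (w *: translate (p1 := p1) y' + b') =
      w *: translate (p1 := p1) (y * y')%g + (translate (p1 := p1) y \o b').
    apply/funext => f; rewrite opDE opZE /= -translate_translate.
    exact: lp_ext.
  exact: translate_span_cons.
have -> : (z *: translate (p1 := p1) y + a) \o b =
    z *: (translate (p1 := p1) y \o b) + (a \o b) by [].
by apply: translate_spanD abW; exact: translate_spanZ.
Qed.

Lemma rnorm_lambda (f : l1) (xi : lp) : rnorm (lambda f xi) <= rnorm f * rnorm xi.
Proof.
have fx0 : 0 <= rnorm f * rnorm xi by rewrite mulr_ge0 ?rnorm_ge0.
by apply/(lpnorm_leP (lambda f xi) fx0) => F; exact: young.
Qed.

Lemma lambda_linear (z : C) (f g : l1) :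
  lambda (p1 := p1) (z *: f + g) = z *: lambda (p1 := p1) f + lambda (p1 := p1) g.
Proof.
apply/funext => xi; apply/lp_ext => x; rewrite opDE opZE lpDE lpZE.
rewrite -csum_linear; [|exact: convolution_summable..].
by congr csum; apply/funext => y; rewrite lpDE lpZE mulrDl mulrA.
Qed.

(** Every partial sum over a finite set containing [y] already equals the value of the translate. *)
Lemma lambda_delta (y : G) :
  lambda (p1 := p1) (delta (lexx (1 : R)) y) = translate (p1 := p1) y.
Proof.
apply/funext => xi; apply/lp_ext => x /=; apply: csum_unique => e e0.
exists [fset y]%fset => A; rewrite fsub1set => yA.
rewrite (big_fsetD1 y)//= eqxx mul1r big1_seq ?addr0 ?subrr ?rnorm0// => y'.
by rewrite !inE => /andP[_ /andP[/negPf -> _]]; rewrite mul0r.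
Qed.

Lemma lambda0 : lambda (p1 := p1) (0 : l1) = 0.
Proof.
have /(congr1 (fun a => a - lambda (p1 := p1) (0 : l1))) := lambda_linear 1 0 0.
by rewrite scaler0 addr0 scale1r addrK subrr.
Qed.

Lemma translate_span_lambda a : translate_span a -> range (lambda (p1 := p1)) a.
Proof.
elim=> [|z y b _ [f _ <-]]; first by exists 0 => //; exact: lambda0.
by exists (z *: delta _ y + f) => //; rewrite lambda_linear lambda_delta.
Qed.

Lemma lambda_trunc_translate_span (A : {fset G}) (h : G -> C) :
  translate_span (lambda (trunc (lexx (1 : R)) A h)).
Proof.
rewrite /trunc; elim: (enum_fset A) => [|y s ih].
  by rewrite big_nil lambda0; exact: translate_span0.
by rewrite big_cons lambda_linear lambda_delta; exact: translate_span_cons.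
Qed.

(** Truncations of [f] converge to [f] in [l1], and the operator norm of [lambda] is dominated by
    the [l1] norm. So [lambda f] is a limit of finite combinations of translations, and a second
    closure adds nothing. *)
Lemma reduced_group_algebraE :
  reduced_group_algebra G p1 = opclosure translate_span.
Proof.
apply/seteqP; split; last first.
  by apply: opclosure_mono => a; exact: translate_span_lambda.
have lW : range (lambda (p1 := p1)) `<=` opclosure translate_span.
  move=> _ [f _ <-]; apply/(opclosureP _ bounded_op_translate_span).
  split=> [|e e0]; first exact: lambda_bounded.
  have [A fA] := lp_tail f e0.
  exists (lambda (trunc (lexx (1 : R)) A f)) => [|xi].
    exact: lambda_trunc_translate_span.
  move: (fA A (fsubset_refl A)); generalize (trunc (lexx (1 : R)) A f) => t ft.
  have -> : lambda f xi - lambda t xi = lambda (p1 := p1) (f - t) xi.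
    have := lambda_linear 1 (f - t) t; rewrite !scale1r subrK => ->.
    by rewrite opDE addrK.
  apply: le_trans (rnorm_lambda _ _) _; apply: ler_wpM2r; first exact: rnorm_ge0.
  exact: ft.
apply: subset_trans (opclosure_mono lW) _.
exact: opclosure_opclosure bounded_op_translate_span.
Qed.

Lemma reduced_group_algebra_subalgebra :
  subalgebra (reduced_group_algebra G p1) (reduced_group_algebra G p1).
Proof.
rewrite reduced_group_algebraE; have Wb := bounded_op_translate_span; split.
- exact: subset_refl.
- exact: (subset_opclosure Wb translate_span0).
- move=> a b; exact: (opclosureD Wb translate_spanD).
- move=> z a; exact: (opclosureZ Wb (@translate_spanZ z)).
- move=> a b; exact: (opclosure_comp Wb translate_span_comp).
Qed.

End TranslateSpan.

Lemma rnorm_pair_lt (R : realType) (V : normedModType R[i]) (u : V * V) (e : R) :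
  rnorm u.1 < e -> rnorm u.2 < e -> rnorm u < e.
Proof.
move=> u1 u2; rewrite -rnorm_lt prod_normE comparable_gt_max ?rnorm_lt ?u1//.
by apply: real_comparable; exact: normr_real.
Qed.

(** * Resolvents and commutators of the closed operator of multiplication by [L] *)

Section LengthOperator.
Context {R : realType} (G : groupType) (p : R) (p1 : 1 <= p) (L : G -> R).
Context (lenL : length_function L) (propL : proper_length L).
Local Notation C := R[i].
Local Notation lp := (lp G p1).
Local Notation D := (length_operator p1 L).

(** The closure has the maximal domain: truncating [f] and [g = L f] to one common finite set stays
    in the graph over [C_c(G)] and approximates both. *)
Lemma length_graphP (f g : lp) :
  graph D (f, g) <-> forall x, g x = (L x)%:C * f x.
Proof.
split=> [/mul_graph_Cc_closure //|gf]; apply/closure_rnormP => e e0.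
have e2 : 0 < e / 2 by rewrite divr_gt0.
have [A1 fA] := lp_tail f e2; have [A2 gA] := lp_tail g e2.
pose A := (A1 `|` A2)%fset.
exists (trunc p1 A f, trunc p1 A g).
  split=> [|x] /=.
    apply: (@sub_finite_set _ _ [set` A]) => [x /=|]; last exact: finite_fset.
    by rewrite truncE; case: ifP => //; rewrite eqxx.
  by rewrite !truncE; case: ifP; rewrite ?mulr0.
have ee : e / 2 < e by rewrite ltr_pdivrMr// ltr_pMr// ltr1n.
have h1 : rnorm (f - trunc p1 A f) < e.
  by apply: le_lt_trans ee; apply: fA; exact: fsubsetUl.
have h2 : rnorm (g - trunc p1 A g) < e.
  by apply: le_lt_trans ee; apply: gA; exact: fsubsetUr.
by apply: rnorm_pair_lt; [exact: h1|exact: h2].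
Qed.

Lemma length_large (r : R) : exists A : {fset G}, forall x, x \notin A -> r < L x.
Proof.
(* Properness speaks of nonnegative radii only, whereas [r] may be negative. *)
have fr : finite_set [set x | L x <= `|r|] by exact: propL.
exists (fset_set [set x | L x <= `|r|]) => x.
rewrite in_fset_set// notin_setE /= => /negP; rewrite -ltNge.
by apply: le_lt_trans; exact: ler_norm.
Qed.

(** Subadditivity for [y^-1 * x] gives one bound, for [x = y * (y^-1 * x)] the other. *)
Lemma length_dist (x y : G) : `|L x - L (y^-1 * x)%g| <= L y.
Proof.
have [_ _ Lmul Linv] := lenL.
rewrite ler_norml; apply/andP; split.
  rewrite lerNl opprB lerBlDr -(Linv y); exact: Lmul.
by rewrite lerBlDr -[in leLHS](mulVKg y x); exact: Lmul.
Qed.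

(** The commutator is translation by [y] followed by multiplication by [L x - L (y^-1 x)], a
    function bounded by [L y]. *)
Lemma translate_commutator (y : G) : bounded_commutator D (@translate R G p p1 y).
Proof.
pose m x : C := (L x - L (y^-1 * x)%g)%:C.
have mL x : rnorm (m x) <= L y by rewrite rnormC length_dist.
have [b bE] := mul_op_exists p1 mL; have bb := bounded_op_mul mL bE.
split=> [f [g /length_graphP gf]|].
  exists (b (translate y f) + translate y g); apply/length_graphP => x.
  by rewrite lpDE bE /= gf -mulrDl /m -rmorphD/= subrK.
exists (b \o translate y).
  exact: bounded_op_comp bb (bounded_op_translate p1 y).
move=> f g h /length_graphP gf /length_graphP hf; apply/lp_ext => x.
by rewrite lpDE lpNE /= bE hf /= gf -mulrBl /m rmorphB.
Qed.

Lemma translate_span_commutator : @translate_span R G p p1 `<=` bounded_commutator D.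
Proof.
move=> a; elim=> [|z y {}a _ ca]; first exact: bounded_commutator0.
by apply: bounded_commutatorD ca; apply/bounded_commutatorZ/translate_commutator.
Qed.

(** Applying [D - z] to [b f] pointwise shows that any bounded inverse [b] is multiplication by
    [(L x - z)^-1], which tends to 0 at infinity because [L] is proper. *)
Lemma length_resolvent (z : C) : ~ spectrum D z ->
  exists2 b, bounded_inverse (shift_graph D z) b & compact_op b.
Proof.
move=> /contrapT[b bi]; exists b => //; have [bb bT] := bi.
have bL (f : lp) x : f x = ((L x)%:C - z) * b f x.
  have /bT/length_graphP/(_ x) := erefl (b f).
  by rewrite lpDE lpZE mulrBl => <-; rewrite addrK.
(* If [L x = z], every function in the range of [D - z], that is all of [lp], would vanish at [x];
   [delta x] does not. *)
have Lz x : (L x)%:C - z != 0.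
  apply/eqP => Lz0; have := bL (delta p1 x) x.
  by rewrite Lz0 mul0r /= eqxx; apply/eqP/oner_neq0.
apply: (@compact_op_mul _ _ _ _ (fun x => ((L x)%:C - z)^-1) b bb).
  by move=> f x; rewrite [in RHS]bL mulKf.
(* Beyond this threshold [|L x - z| >= L x - |z| >= e^-1]. *)
move=> e e0; have [A AL] := length_large (rnorm z + e^-1).
exists A => x /AL Lx; have ei : 0 < e^-1 by rewrite invr_gt0.
have eLz : e^-1 <= rnorm ((L x)%:C - z).
  rewrite -(lerD2l (rnorm z)) (le_trans (ltW Lx))//.
  apply: le_trans (ler_norm _) _; rewrite -rnormC -[X in rnorm X <= _](subrK z).
  by rewrite addrC rnormD.
have rLz : 0 < rnorm ((L x)%:C - z) by exact: lt_le_trans eLz.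
rewrite -(ler_pM2l rLz) -rnormM mulfV// rnorm1.
by rewrite -(mulVf (lt0r_neq0 e0)) ler_wpM2r// ltW.
Qed.

(** The inverse is multiplication by [m = 1 / (1 + L^2)]. Its values lie in the domain of [D^2]
    because [L m] and [L^2 m] are bounded by 1. *)
Lemma length_one_plus_square :
  exists2 b, bounded_inverse (one_plus_square_graph D) b & compact_op b.
Proof.
pose s x : R := 1 + L x ^+ 2.
have s0 x : 0 < s x by rewrite ltr_pwDl// sqr_ge0.
have L0 x : 0 <= L x by case: lenL.
have s1 x : 1 <= s x by rewrite lerDl sqr_ge0.
(* Serves twice: it bounds [L m] by 1, and it makes [m] small wherever [L] is large. *)
have Ls x : L x <= s x.
  have [L1|/ltW L1] := lerP (L x) 1; first exact: le_trans (s1 x).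
  by apply: (@le_trans _ _ (L x ^+ 2)); [exact: ler_eXnr|rewrite lerDr].
pose l x : C := (L x)%:C; pose m x : C := (s x)^-1%:C.
have mK x : m x * (1 + l x * l x) = 1.
  have -> : 1 + l x * l x = (s x)%:C by rewrite /s rmorphD rmorph1 rmorphXn expr2.
  by rewrite -rmorphM/= mulVf ?gt_eqF.
have rm x : rnorm (m x) = (s x)^-1 by rewrite rnormC ger0_norm ?invr_ge0 ?ltW.
have rl x : rnorm (l x) = L x by rewrite rnormC ger0_norm.
have m1 x : rnorm (m x) <= 1 by rewrite rm invf_le1.
have lm1 x : rnorm (l x * m x) <= 1.
  by rewrite rnormM rl rm ler_pdivrMr// mul1r.
have llm1 x : rnorm (l x * (l x * m x)) <= 1.
  by rewrite !rnormM rl rm mulrA -expr2 ler_pdivrMr// mul1r lerDr.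
have [b bE] := mul_op_exists p1 m1; have bb := bounded_op_mul m1 bE.
have [b1 b1E] := mul_op_exists p1 lm1; have [b2 b2E] := mul_op_exists p1 llm1.
exists b; last first.
  apply: (compact_op_mul bb bE) => e e0; have [A AL] := length_large e^-1.
  exists A => x /AL Lx; rewrite rm -[leRHS]invrK lef_pV2 ?posrE ?invr_gt0//.
  exact: le_trans (ltW Lx) (Ls x).
split=> // f g; split=> [[y [z [/length_graphP fy /length_graphP yz /= gE]]]|fE].
  apply/lp_ext => x; rewrite bE gE lpDE yz fy -[LHS]mul1r -(mK x) /l.
  by ring.
(* With [f = b g], these are [D f] and [D^2 f]. *)
exists (b1 g), (b2 g); split=> /=.
- by apply/length_graphP => x; rewrite b1E fE bE mulrA.
- by apply/length_graphP => x; rewrite b1E b2E -!mulrA.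
- apply/lp_ext => x; rewrite lpDE fE bE b2E -[LHS]mul1r -(mK x).
  by ring.
Qed.

End LengthOperator.

Theorem theorem4p2 (R : realType) (p : R) (p1 : 1 <= p) (G : groupType)
    (cG : countable [set: G]) (L : G -> R) (lenL : length_function L)
    (propL : proper_length L) :
  is_spectral_triple (reduced_group_algebra G p1) (length_operator p1 L).
Proof.
have algA := reduced_group_algebra_subalgebra G p1.
have bA : reduced_group_algebra G p1 `<=` @bounded_op R _ by move=> a [].
split.
- exact: length_one_plus_square.
- exact: length_resolvent.
- exact: commutator_algebra_subalgebra.
(* Density: the algebra is the closure of [translate_span], whose members all have bounded
   commutator with [D]. *)
- rewrite [X in X `<=` _]reduced_group_algebraE; apply: opclosure_mono => a aW.
  split; last exact: translate_span_commutator.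
  by rewrite reduced_group_algebraE;
  exact: subset_opclosure (@bounded_op_translate_span _ _ _ p1) _ aW.
Qed.
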